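(* Let $\mathcal{S}=(G(V,E),(S_e)_{e\in E})$, $V=\{1,\dots,n\}$, be a strongly connected graph-directed iterated function system in $\mathbb{R}^d$ such that $S_e$ is one-to-one for every $e\in E$, and let $(A_1,\dots,A_n)$ be its attractor. Assume that $A_i\setminus\Theta(A_i)\neq\emptyset$ for all $i\in V$, where $\Theta(A_i)$ is the collection of trivial connected components of $A_i$. Then $A_i\setminus\Theta(A_i)$ is dense in $A_i$ for all $i\in V$. This implies that either $\overline{\dim}_B(A_i\setminus\Theta(A_i))=\overline{\dim}_B(A_i)$ and $\underline{\dim}_B(A_i\setminus\Theta(A_i))=\underline{\dim}_B(A_i)$, or $A_i\setminus\Theta(A_i)=\emptyset$, for all $i\in V$.
   Context: A graph-directed iterated function system (GDIFS) in $\mathbb{R}^d$ is a pair $\mathcal{S}=(G(V,E),(S_e)_{e\in E})$, where $G(V,E)$ is a directed graph with vertex set $V=\{1,\dots,n\}$ and finite set $E$ of directed edges (several edges between the same vertices and loops are allowed), such that every vertex has at least one edge starting from it, and each $S_e:\mathbb{R}^d\to\mathbb{R}^d$ is a contraction (Lipschitz constant $<1$). For $i,k\in V$, $E_{i,k}$ denotes the set of edges from $i$ to $k$. The attractor of $\mathcal{S}$ is the unique $n$-tuple $(A_1,\dots,A_n)$ of nonempty compact subsets of $\mathbb{R}^d$ such that $A_i=\bigcup_{k=1}^n\bigcup_{e\in E_{i,k}}S_e(A_k)$ for each $i\in V$. $\mathcal{S}$ is strongly connected if for all $i,j\in V$ there is a directed path from $i$ to $j$. A trivial connected component is one consisting of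 a single point; $\Theta(A_i)$, viewed as a subset of $A_i$, is the set of points $x\in A_i$ whose connected component in $A_i$ is $\{x\}$. For a nonempty bounded set $F\subset\mathbb{R}^d$, let $N_\delta(F)$ be the smallest number of sets of diameter at most $\delta$ which cover $F$. The lower and upper box dimensions are $\underline{\dim}_B(F)=\liminf_{\delta\to0}\frac{\ln N_\delta(F)}{-\ln\delta}$ and $\overline{\dim}_B(F)=\limsup_{\delta\to0}\frac{\ln N_\delta(F)}{-\ln\delta}$. *)

(* Defs.v *)
From HB Require Import structures.
From mathcomp Require Import all_boot all_order all_algebra.
From mathcomp Require Import all_classical all_reals all_analysis.

Set Implicit Arguments.
Unset Strict Implicit.
Unset Printing Implicit Defensive.

Import Order.TTheory GRing.Theory Num.Theory.
Import numFieldNormedType.Exports.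

Local Open Scope classical_set_scope.
Local Open Scope ring_scope.

(* The library norm on 'rV[R]_d is the sup norm. It induces the usual topology,
   but Lipschitz constants and diameters are taken here, as usual in R^d, for
   the Euclidean distance. *)
Definition eucl_dist (R : realType) (d : nat) (x y : 'rV[R]_d) : R :=
  Num.sqrt (\sum_(j < d) (x 0 j - y 0 j) ^+ 2).

Definition is_contraction (R : realType) (d : nat)
    (f : 'rV[R]_d -> 'rV[R]_d) : Prop :=
  exists c : R, [/\ 0 <= c, c < 1
    & forall x y : 'rV[R]_d, eucl_dist (f x) (f y) <= c * eucl_dist x y].

Record gdifs (R : realType) (d n : nat) := Gdifs {
  edge : finType;
  source : edge -> 'I_n;
  target : edge -> 'I_n;
  gmap : edge -> 'rV[R]_d -> 'rV[R]_d;
  out_edge : forall i : 'I_n, exists e : edge, source e = i;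
  gmap_contraction : forall e : edge, is_contraction (gmap e)
}.

Arguments edge {R d n} _.
Arguments source {R d n _} _.
Arguments target {R d n _} _.
Arguments gmap {R d n _} _ _.

Definition edges_between (R : realType) (d n : nat) (S : gdifs R d n)
    (i k : 'I_n) : set (edge S) :=
  [set e | source e = i /\ target e = k].

Arguments edges_between {R d n} S i k.

(* [connect] also allows the empty path from i to i; since every vertex has an
   outgoing edge, requiring nonempty paths would give the same notion. *)
Definition strongly_connected (R : realType) (d n : nat)
    (S : gdifs R d n) : Prop :=
  forall i j : 'I_n,
    connect [rel u v | [exists e : edge S, (source e == u) && (target e == v)]]
      i j.

Definition is_attractor (R : realType) (d n : nat) (S : gdifs R d n)
    (A : 'I_n -> set 'rV[R]_d) : Prop :=
  forall i : 'I_n, [/\ A i !=set0, compact (A i)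
    & A i = \bigcup_(k in [set: 'I_n])
              \bigcup_(e in edges_between S i k) (gmap e @` A k)].

Definition trivial_components (T : topologicalType) (A : set T) : set T :=
  [set x | A x /\ connected_component A x = [set x]].

(* [dense] of the library is density in the whole space. *)
Definition dense_in (T : topologicalType) (B A : set T) : Prop :=
  B `<=` A /\ A `<=` closure B.

(* The diameter of the empty set is -oo, hence at most any real number. *)
Definition diameter (R : realType) (d : nat) (U : set 'rV[R]_d) : \bar R :=
  ereal_sup [set (eucl_dist p.1 p.2)%:E | p in U `*` U].

Definition coverable (R : realType) (d : nat) (F : set 'rV[R]_d) (delta : R)
    (m : nat) : Prop :=
  exists U : 'I_m -> set 'rV[R]_d,
    (forall j : 'I_m, (diameter (U j) <= delta%:E)%E) /\
    F `<=` \bigcup_(j in [set: 'I_m]) U j.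

(* The default value 0 is only taken when no finite cover exists, which does
   not happen for bounded F and delta > 0. *)
Definition covering_number (R : realType) (d : nat) (F : set 'rV[R]_d)
    (delta : R) : nat :=
  xget 0%N [set m | coverable F delta m /\
                    forall k : nat, coverable F delta k -> (m <= k)%N].

Definition box_ratio (R : realType) (d : nat) (F : set 'rV[R]_d)
    (delta : R) : \bar R :=
  (ln (covering_number F delta)%:R / - ln delta)%:E.

Definition lower_box_dim (R : realType) (d : nat) (F : set 'rV[R]_d) : \bar R :=
  limf_einf (box_ratio F) (0 : R)^'+.

Definition upper_box_dim (R : realType) (d : nat) (F : set 'rV[R]_d) : \bar R :=
  limf_esup (box_ratio F) (0 : R)^'+.

(* Main.v *)
Require Import Defs.
From mathcomp Require Import all_boot all_order all_algebra.
From mathcomp Require Import all_classical all_reals all_analysis.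

(** Write N_i for the union of the nondegenerate connected components of A_i.

An injective continuous map carries a nondegenerate connected set to a
nondegenerate connected set, so every S_e sends N_k into N_i when e goes from i
to k ([nontrivial_component_image]). Hence one nonempty N_k makes every N_i
nonempty, by walking backward along a path from i to k.

Density only uses that the sets N_i are nonempty and form a family invariant
under the maps ([invariant_family_dense]). Fix a point b_k in each N_k, and let
M bound the distance from b_k to all points of A_k. A point x of A_i is the
image of some point of some A_k under a composition of m of the maps; the image
of b_k under the same composition lies in N_i, and is within c^m M of x, where
c < 1 is a common contraction ratio.

Closing the members of a finite cover does not increase their diameters, and
the closed members cover the closure. A set and a dense subset of it therefore
have exactly the same finite covering numbers at every scale
([dense_box_ratio]), so that both box dimensions agree. *)

Set Implicit Arguments.
Unset Strict Implicit.
Unset Printing Implicit Defensive.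

Import numFieldNormedType.Exports.

Local Open Scope classical_set_scope.

Import Order.TTheory GRing.Theory Num.Theory.
Local Open Scope ring_scope.

Lemma eucl_dist_sym (R : realType) (d : nat) (x y : 'rV[R]_d) :
  eucl_dist x y = eucl_dist y x.
Proof.
by congr Num.sqrt; apply: eq_bigr => j _; rewrite -sqrrN opprB.
Qed.

Lemma eucl_distxx (R : realType) (d : nat) (x : 'rV[R]_d) :
  eucl_dist x x = 0.
Proof.
by rewrite /eucl_dist big1 ?sqrtr0// => j _; rewrite subrr expr0n.
Qed.

Lemma coord_le_eucl_dist (R : realType) (d : nat) (x y : 'rV[R]_d) (j : 'I_d) :
  `|x 0 j - y 0 j| <= eucl_dist x y.
Proof.
rewrite -sqrtr_sqr; apply: ler_wsqrtr.
by rewrite (bigD1 j)//= lerDl sumr_ge0// => k _; exact: sqr_ge0.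
Qed.

Lemma eucl_dist_continuous (R : realType) (d : nat) (x : 'rV[R]_d) :
  continuous (eucl_dist x).
Proof.
have coordB j : continuous (fun y : 'rV[R]_d => x 0 j - y 0 j).
  move=> y; apply: (@continuousB _ R^o); first exact: cst_continuous.
  exact: coord_continuous.
have summand j : continuous (fun y : 'rV[R]_d => (x 0 j - y 0 j) ^+ 2).
  move=> y; apply: (continuous_comp (g := fun t : R => t ^+ 2) (coordB j y)).
  exact: exprn_continuous.
move=> y; apply: continuous_comp; last exact: sqrt_continuous.
by apply: cvg_big => [||j _];
  [exact: add_continuous | exact: nbhs_filter | exact: summand].
Qed.

(** Euclidean balls are a neighbourhood base of the topology that comes from the
sup norm; beyond this point only the Euclidean distance is needed. *)
Lemma nbhs_eucl_distP (R : realType) (d : nat) (x : 'rV[R]_d)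
    (U : set 'rV[R]_d) :
  nbhs x U <-> exists2 r : R, 0 < r & forall y, eucl_dist x y < r -> U y.
Proof.
split=> [/nbhs_ballP[r /= r0 rU]|[r r0 rU]].
  exists r => // y xyr; apply: rU; split=> // i j.
  by rewrite (ord1 i); exact: le_lt_trans (coord_le_eucl_dist _ _ _) xyr.
apply: filterS rU _.
have /cvgr_lt := @eucl_dist_continuous _ _ x x.
by apply; rewrite eucl_distxx.
Qed.

Lemma contraction_continuous (R : realType) (d : nat)
    (f : 'rV[R]_d -> 'rV[R]_d) :
  Defs.is_contraction f -> continuous f.
Proof.
move=> [c [c0 c1 fc]] x U /nbhs_eucl_distP[r r0 rU].
apply/nbhs_eucl_distP; exists r => // y xy; apply: rU.
apply: le_lt_trans (fc x y) (le_lt_trans _ xy).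
by rewrite ler_piMl ?sqrtr_ge0// ltW.
Qed.

(** If the component of f x in B were {f x}, then the image of the component of
x in A, a connected subset of B through f x, would be {f x}; injectivity would
reduce the component of x to {x}. *)
Lemma nontrivial_component_image (T U : topologicalType) (f : T -> U)
    (A : set T) (B : set U) :
  continuous f -> injective f -> f @` A `<=` B ->
  f @` (A `\` trivial_components A) `<=` B `\` trivial_components B.
Proof.
move=> cf inj_f fAB _ [x [Ax ntx] <-]; split; first by apply: fAB; exists x.
move=> [_ compfx]; apply: ntx; split=> //.
apply/seteqP; split=> [y xy|_ ->]; last exact: connected_component_refl.
apply: inj_f; suff : connected_component B (f x) (f y) by rewrite compfx.
apply: (@connected_component_max _ _ (f @` connected_component A x)).
- by exists x => //; exact: connected_component_refl.
- move=> _ [z /connected_component_sub Az <-]; apply: fAB; by exists z.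
- apply: connected_continuous_connected; first exact: component_connected.
  exact: continuous_subspaceT.
- by exists y.
Qed.

Lemma attractor_decompose (R : realType) (d n : nat) (S : gdifs R d n)
    (A : 'I_n -> set 'rV[R]_d) (i : 'I_n) (x : 'rV[R]_d) :
  is_attractor S A -> A i x ->
  exists e : edge S, source e = i /\ exists2 y, A (target e) y & gmap e y = x.
Proof.
move=> /(_ i)[_ _ ->] [k _ [e [ei ek] [y Ay <-]]].
by exists e; split=> //; exists y => //; rewrite ek.
Qed.

Lemma attractor_image (R : realType) (d n : nat) (S : gdifs R d n)
    (A : 'I_n -> set 'rV[R]_d) (e : edge S) :
  is_attractor S A -> gmap e @` A (target e) `<=` A (source e).
Proof.
move=> /(_ (source e))[_ _ ->] x Sx.
by exists (target e) => //; exists e.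
Qed.

(** The largest of finitely many ratios is still less than 1; starting the
maximum at 0 covers the case of no edge. *)
Lemma common_contraction_ratio (R : realType) (d n : nat) (S : gdifs R d n) :
  exists c : R, [/\ 0 <= c, c < 1 & forall (e : edge S) x y,
    eucl_dist (gmap e x) (gmap e y) <= c * eucl_dist x y].
Proof.
have /choice[c cP] := @gmap_contraction R d n S.
exists (\big[Num.max/0]_e c e); split.
- exact: bigmax_ge_id.
- by apply: bigmax_lt => // e _; have [] := cP e.
- move=> e x y; have [_ _ /(_ x y)/le_trans] := cP e; apply.
  by apply: ler_wpM2r; [exact: sqrtr_ge0 | exact: le_bigmax].
Qed.

(** Measuring from one base point is enough for the approximation argument, and
lets continuity on a compact set replace an estimate on the diameter. *)
Lemma compact_eucl_dist_bounded (R : realType) (d : nat) (A : set 'rV[R]_d)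
    (b : 'rV[R]_d) :
  compact A -> exists D : R, forall x, A x -> eucl_dist b x <= D.
Proof.
move=> cA; have : compact (eucl_dist b @` A).
  apply: continuous_compact cA; apply: continuous_subspaceT.
  exact: eucl_dist_continuous.
move=> /compact_bounded[M [_ /(_ (M + 1))]]; rewrite ltrDl ltr01 => /(_ isT) MP.
exists (M + 1) => x Ax; apply: le_trans (ler_norm _) _.
by apply: (MP (eucl_dist b x)); exists x.
Qed.

(** The same mechanism as the uniqueness of the attractor: images of base points
under compositions of m maps approach every point of the attractor at the
geometric rate c^m, and never leave the invariant family B. *)
Lemma invariant_family_dense (R : realType) (d n : nat) (S : gdifs R d n)
    (A B : 'I_n -> set 'rV[R]_d) :
  is_attractor S A -> (forall i, B i !=set0) ->
  (forall e : edge S, gmap e @` B (target e) `<=` B (source e)) ->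
  forall i, A i `<=` closure (B i).
Proof.
move=> Aattr /choice[b bB] SB.
have [c [c0 c1 Sc]] := common_contraction_ratio S.
have /choice[D DP] : forall i, exists D : R,
    forall x, A i x -> eucl_dist (b i) x <= D.
  by move=> i; apply: compact_eucl_dist_bounded; have [] := Aattr i.
pose M := \big[Num.max/0]_i D i.
(* Peeling off the first map of a composition gives an induction on m over all
   vertices at once, which avoids handling paths of edges. *)
have approx m : forall i x, A i x ->
    exists2 y, B i y & eucl_dist y x <= c ^+ m * M.
  elim: m => [|m IHm] i x Ax.
    exists (b i) => //; rewrite expr0 mul1r; apply: le_trans (DP i x Ax) _.
    exact: le_bigmax.
  have [e [<- [x' /IHm[y' By' dy'] <-]]] := attractor_decompose Aattr Ax.
  exists (gmap e y'); first by apply: SB; exists y'.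
  by rewrite exprS -mulrA; apply: le_trans (Sc e _ _) (ler_wpM2l c0 dy').
move=> i x Ax U /nbhs_eucl_distP[r r0 rU].
have [m cmr] : exists m, c ^+ m * M < r.
  have : c ^+ m * M @[m --> \oo] --> 0.
    rewrite -(mul0r M); apply: cvgM; last exact: cvg_cst.
    by apply: cvg_expr; rewrite ger0_norm.
  move=> /cvgr_lt/(_ r r0)[m _ mP]; exists m; exact: mP (leqnn m).
have [y By yx] := approx m i x Ax.
by exists y; split=> //; apply: rU; rewrite eucl_dist_sym (le_lt_trans yx).
Qed.

Lemma diameter_leP (R : realType) (d : nat) (U : set 'rV[R]_d) (r : R) :
  (diameter U <= r%:E)%E <-> forall x y, U x -> U y -> eucl_dist x y <= r.
Proof.
split=> [Ur x y Ux Uy|Ur].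
  rewrite -lee_fin; apply: le_trans Ur.
  by apply: ereal_sup_ubound; exists (x, y).
by apply: ge_ereal_sup => _ [[x y] [/= Ux Uy] <-]; rewrite lee_fin; exact: Ur.
Qed.

(** A closed disc that contains U contains its closure; this is applied once in
each of the two variables of the distance. *)
Lemma diameter_closure_le (R : realType) (d : nat) (U : set 'rV[R]_d) (r : R) :
  (diameter U <= r%:E)%E -> (diameter (closure U) <= r%:E)%E.
Proof.
move=> /diameter_leP Ur; apply/diameter_leP.
have disc_closure (x : 'rV[R]_d) : U `<=` [set y | eucl_dist x y <= r] ->
    closure U `<=` [set y | eucl_dist x y <= r].
  move=> Ux; suff /closure_id-> : closed [set y | eucl_dist x y <= r].
    exact: closureS.
  have /continuous_closedP/(_ [set t | t <= r]) := @eucl_dist_continuous _ _ x.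
  by apply; exact: closed_le.
move=> x y cUx; apply: (disc_closure x) => // z Uz /=; rewrite eucl_dist_sym.
by apply: (disc_closure z) cUx => x' Ux'; exact: Ur.
Qed.

(** Finiteness of the cover matters: the union of the closed members is closed,
hence contains the closure of F. *)
Lemma coverable_closure (R : realType) (d : nat) (F : set 'rV[R]_d) (delta : R)
    (m : nat) :
  coverable F delta m -> coverable (closure F) delta m.
Proof.
move=> [U [Ud FU]]; exists (fun j => closure (U j)); split=> [j|].
  exact: diameter_closure_le.
have /closure_id-> : closed (\bigcup_(j in [set: 'I_m]) closure (U j)).
  by by apply: closed_bigcup => [|j _]; [exact: finite_finset |
    exact: closed_closure].
apply: closureS => x /FU[j _ Ux]; exists j => //; exact: subset_closure.
Qed.

Lemma coverable_subset (R : realType) (d : nat) (F G : set 'rV[R]_d) (delta : R)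
    (m : nat) :
  F `<=` G -> coverable G delta m -> coverable F delta m.
Proof. by move=> FG [U [Ud GU]]; exists U; split=> // x /FG/GU. Qed.

(** The covers of F and of G by m sets of diameter at most delta exist for the
same m, so equality holds at each scale and no limit has to be compared. *)
Lemma dense_box_ratio (R : realType) (d : nat) (F G : set 'rV[R]_d) :
  dense_in F G -> box_ratio F = box_ratio G.
Proof.
move=> [FG GF]; apply/funext => delta.
have covE : coverable F delta = coverable G delta.
  apply/funext => m; apply/propext; split; last exact: coverable_subset.
  by move=> /coverable_closure; exact: coverable_subset.
by rewrite /box_ratio /covering_number covE.
Qed.

Lemma strongly_connected_propagate (R : realType) (d n : nat) (S : gdifs R d n)
    (P : 'I_n -> Prop) :
  strongly_connected S ->
  (forall e : edge S, P (target e) -> P (source e)) ->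
  forall i k, P k -> P i.
Proof.
move=> conS PS i k; have /connectP[p] := conS i k.
elim: p i => [i _ -> //|j p IHp i /=].
move=> /andP[/existsP[e /andP[/eqP<- /eqP ej]] jp].
by move=> kp Pk; apply: PS; rewrite ej; exact: IHp.
Qed.

Local Close Scope ring_scope.

Theorem theorem2p2 (R : realType) (d n : nat) (S : gdifs R d n)
    (S_connected : strongly_connected S)
    (S_injective : forall e : edge S, injective (gmap e))
    (A : 'I_n -> set 'rV[R]_d) (A_attractor : is_attractor S A) :
  ((forall i : 'I_n, A i `\` trivial_components (A i) !=set0) ->
   forall i : 'I_n, dense_in (A i `\` trivial_components (A i)) (A i)) /\
  ((forall i : 'I_n,
      [/\ A i `\` trivial_components (A i) !=set0,
          upper_box_dim (A i `\` trivial_components (A i)) =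
            upper_box_dim (A i)
        & lower_box_dim (A i `\` trivial_components (A i)) =
            lower_box_dim (A i)]) \/
   (forall i : 'I_n, A i `\` trivial_components (A i) = set0)).
Proof.
have inv (e : edge S) :
    gmap e @` (A (target e) `\` trivial_components (A (target e))) `<=`
    A (source e) `\` trivial_components (A (source e)).
  have cont := contraction_continuous (gmap_contraction e).
  apply: (nontrivial_component_image cont (S_injective e)).
  exact: attractor_image.
have density : (forall i, A i `\` trivial_components (A i) !=set0) ->
    forall i, dense_in (A i `\` trivial_components (A i)) (A i).
  move=> ne i; split; first exact: subDsetl.
  exact: (invariant_family_dense A_attractor ne inv).
split=> //.
have [[k nek]|allE] := pselect (exists k,
    A k `\` trivial_components (A k) !=set0).
  have ne i : A i `\` trivial_components (A i) !=set0.
    pose P j := A j `\` trivial_components (A j) !=set0.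
    have backward (e : edge S) : P (target e) -> P (source e).
      by move=> [x Nx]; exists (gmap e x); apply: inv; exists x.
    exact: (strongly_connected_propagate S_connected backward i nek).
  left=> i; have ratioE := dense_box_ratio (density ne i).
  by split=> //; rewrite /upper_box_dim /lower_box_dim ratioE.
right=> i; apply: contrapT => /eqP/set0P nei; by apply: allE; exists i.
Qed.
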